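(* Let $K$ be a nonempty compact convex set in $\mathbb{R}^n$ and $u$ a unit vector. Then $$\Omega(\mathrm{s}_uK)\ge\Omega(K).$$ If $K$ has nonempty interior, equality holds if and only if $\mathrm{s}_uK=K$.
   Context: For a nonempty compact convex $K\subseteq\mathbb{R}^n$ and a unit vector $u$, the Steiner symmetrization $\mathrm{s}_uK$ is defined as follows: for each point $x$ of the orthogonal projection $\pi_uK$ of $K$ onto $u^\perp$, let $\ell_x(K)$ be the length of the segment $K\cap(x+\mathbb{R}u)$; then $\mathrm{s}_uK=\{x+tu:\ x\in\pi_uK,\ |t|\le \tfrac12\ell_x(K)\}$. $B$ is the closed unit ball centered at the origin, $V_n$ is $n$-dimensional volume. The layering function is $\Omega(K)=\int_0^\infty V_n(K\cap rB)\,e^{-r^2}\,dr$. *)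

(* Defs.v *)
From HB Require Import structures.
From mathcomp Require Import all_boot all_order all_algebra.
From mathcomp Require Import all_classical all_reals all_analysis.
Set Implicit Arguments. Unset Strict Implicit. Unset Printing Implicit Defensive.
Import Order.TTheory GRing.Theory Num.Theory.
Import numFieldNormedType.Exports.
Local Open Scope classical_set_scope.
Local Open Scope ring_scope.

Section Steiner.
Variable R : realType.

Definition edot (n : nat) (x y : 'rV[R]_n) : R := \sum_(i < n) x 0 i * y 0 i.
Definition enorm (n : nat) (x : 'rV[R]_n) : R := Num.sqrt (edot x x).

Definition eball (n : nat) (r : R) : set 'rV[R]_n := [set x | enorm x <= r].

Definition convex_set_rV (n : nat) (K : set 'rV[R]_n) : Prop :=
  forall x y, K x -> K y -> forall l : R, 0 <= l <= 1 ->
    K (l *: x + (1 - l) *: y).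

Definition proj_perp (n : nat) (u : 'rV[R]_n) (K : set 'rV[R]_n) : set 'rV[R]_n :=
  [set x - edot x u *: u | x in K].

Definition chord_length (n : nat) (u : 'rV[R]_n) (K : set 'rV[R]_n)
  (x : 'rV[R]_n) : R :=
  sup [set t : R | K (x + t *: u)] - inf [set t : R | K (x + t *: u)].

Definition steiner (n : nat) (u : 'rV[R]_n) (K : set 'rV[R]_n) : set 'rV[R]_n :=
  [set y | exists x t, proj_perp u K x /\ `|t| <= chord_length u K x / 2
                       /\ y = x + t *: u].

(* n-dimensional Lebesgue volume, written as the iterated Lebesgue integral
   over the coordinates (Tonelli: agrees with the product Lebesgue measure
   on Borel sets, in particular on all compact sets). *)
Definition extend_row (n : nat) (y : 'rV[R]_n) (t : R) : 'rV[R]_n.+1 :=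
  \row_(i < n.+1) (if unlift ord_max i is Some j then y 0 j else t).

Fixpoint iter_integral (n : nat) : ('rV[R]_n -> \bar R) -> \bar R :=
  match n return ('rV[R]_n -> \bar R) -> \bar R with
  | 0 => fun f => f 0
  | m.+1 => fun f =>
      (\int[@lebesgue_measure R]_t iter_integral (fun y => f (extend_row y t)))%E
  end.

Definition volume (n : nat) (A : set 'rV[R]_n) : \bar R :=
  iter_integral (fun x => (\1_A x)%:E).

Definition Omega (n : nat) (K : set 'rV[R]_n) : \bar R :=
  (\int[@lebesgue_measure R]_(r in `[0%R, +oo[%classic)
      (volume (K `&` @eball n r) * (expR (- r ^+ 2))%:E))%E.

End Steiner.

(* Main.v *)
Require Import Defs.
From HB Require Import structures.
From mathcomp Require Import all_boot all_order all_algebra.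
From mathcomp Require Import all_classical all_reals all_analysis.
From mathcomp Require Import measurable_realfun ring lra.
Import Order.TTheory GRing.Theory Num.Theory.
Import numFieldNormedType.Exports.
Local Open Scope classical_set_scope.
Local Open Scope ring_scope.

(** For each radius [r] compare the volumes of [K `&` rB] and
    [steiner u K `&` rB] by Cavalieri's principle along the direction [u]: on a
    line parallel to [u] the ball cuts out an interval centred at [u^perp], and
    among all intervals of a given length the centred one meets it in the
    largest set. If [steiner u K] differs from [K], some interior point [p] of
    [K] has a neighbourhood whose mirror image in [u^perp] misses [K]; for [r]
    slightly above [|p|] the lines near [p] then gain a definite length, hence
    so do the volumes, on an interval of radii. Integrating against the finite
    weight [exp (- r^2)] gives both claims. *)

Set Implicit Arguments.
Unset Strict Implicit.

(** Volume is an iterated integral along the coordinate axes, so [u] cannot simply be rotated onto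
    an axis; comparing volumes along [u] takes an induction on the dimension with a change of
    variables. For the strict case, let [s] be the height of [p] over u^perp. A ball of radius about
    |p| meets the line through [p] in heights from about -s to s. It cuts off the part of the chord
    beyond [s], while the chord stops short of -s, so some of the ball's interval stays empty;
    centring the chord repairs this. A gain at a single radius, or on a single line, would vanish
    under integration. Hence the tolerances [d], [eta] and [kappa] keep it uniform over a cube
    around [p] and an interval of radii, and on each line the gain is measured against the trace of
    that cube, so that the gains add up to the volume of the cube. *)

Section AffineSubstitution.
Variable R : realType.
Notation mu := (@lebesgue_measure R).

Lemma measurable_affine (a b : R) :
  measurable_fun [set: measurableTypeR R] (fun s : measurableTypeR R => a * s + b : measurableTypeR R).
Proof.
by apply: measurable_funD => //; exact: measurable_funM.
Qed.

(** A negative slope exchanges the open and the closed end, which does not affect the length; hence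
    the two cases. *)
Lemma preimage_affine_itvoc (a b x y : R) : a != 0 ->
  mu ((fun s => a * s + b) @^-1` `]x, y]%classic) = ((`|a|^-1)%:E * mu `]x, y]%classic)%E.
Proof.
move=> a0; have [ap|an|a00] := ltgtP 0 a; last by rewrite -a00 eqxx in a0.
- have -> : (fun s => a * s + b) @^-1` `]x, y]%classic = `](x - b) / a, (y - b) / a]%classic.
    apply/seteqP; split=> s /=; rewrite !in_itv/= ltr_pdivrMr// ler_pdivlMr// => /andP[h1 h2];
      apply/andP; split; lra.
  rewrite !lebesgue_measure_itv/= !lte_fin ltr_pM2r ?invr_gt0// ltrD2r.
  case: ifP => _; last by rewrite mule0.
  by rewrite -!EFinD -EFinM gtr0_norm//; congr EFin; ring.
- have -> : (fun s => a * s + b) @^-1` `]x, y]%classic = `[(y - b) / a, (x - b) / a[%classic.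
    apply/seteqP; split=> s /=; rewrite !in_itv/= ltr_ndivlMr// ler_ndivrMr// => /andP[h1 h2];
      apply/andP; split; lra.
  rewrite !lebesgue_measure_itv/= !lte_fin ltr_nM2r ?invr_lt0// ltrD2r.
  case: ifP => _; last by rewrite mule0.
  by rewrite -!EFinD -EFinM ltr0_norm//; congr EFin; field.
Qed.

(** The pushforward of [mu] scaled by |a| is a measure that agrees with [mu] on half-open intervals,
    so it is [mu] by uniqueness. *)
Lemma lebesgue_preimage_affine (a b : R) (A : set R) : a != 0 ->
  measurable A -> mu ((fun s => a * s + b) @^-1` A) = ((`|a|^-1)%:E * mu A)%E.
Proof.
move=> a0 mA.
have na0 : `|a| != 0 by rewrite normr_eq0.
have ms := measurable_affine a b.
have k0 : 0 <= `|a| by [].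
pose m : {measure set (measurableTypeR R) -> \bar R} := mscale (NngNum k0)
  (measure_function_pushforward__canonical__measure_function_Measure mu ms).
have mE B : m B = (`|a|%:E * mu ((fun s => a * s + b)%R @^-1` B))%E by [].
have -> : mu A = m A.
  apply: (@lebesgue_measure_unique R m) => // _ [[x y] _ <-].
  by rewrite mE preimage_affine_itvoc// muleA -EFinM mulfV// mul1e.
by rewrite mE muleA -EFinM mulVf// mul1e.
Qed.

Lemma ge0_integral_affine (a b : R) (f : R -> \bar R) : a != 0 ->
  measurable_fun setT f -> (forall x, 0 <= f x)%E ->
  (\int[mu]_s f (a * s + b)%R = (`|a|^-1)%:E * \int[mu]_s f s)%E.
Proof.
move=> a0 mf f0.
have ms := measurable_affine a b.
have h := @ge0_integral_pushforward _ _ _ _ _ _ ms mu setT f measurableT mf (fun x _ => f0 x).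
rewrite preimage_setT in h.
rewrite -[LHS]h.
have k0 : 0 <= `|a|^-1 by rewrite invr_ge0.
rewrite -(@ge0_integral_mscale _ _ _ mu _ measurableT (NngNum k0) f)//.
apply: eq_measure_integral => B mB _.
exact: lebesgue_preimage_affine.
Qed.

Lemma ge0_integral_shift (b : R) (f : R -> \bar R) :
  measurable_fun setT f -> (forall x, 0 <= f x)%E ->
  (\int[mu]_s f (s + b)%R = \int[mu]_s f s)%E.
Proof.
move=> mf f0; have := @ge0_integral_affine 1 b f (oner_neq0 _) mf f0.
rewrite normr1 invr1 mul1e => <-.
by apply: eq_integral => x _; rewrite mul1r.
Qed.

End AffineSubstitution.

(** * Iterated integrals: measurability, Tonelli, Cavalieri along a direction *)

Section IteratedIntegral.
Variable R : realType.
Notation mu := (@lebesgue_measure R).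

Definition row_measurable d (S : measurableType d) n (g : S -> 'rV[R]_n) :=
  forall i, measurable_fun setT (fun s => g s 0 i).

(* Borel measurability on ['rV[R]_n], where no sigma-algebra is available, is
   expressed through composition with all measurable parametrizations. *)
Definition Borel_param d (T : measurableType d) n (F : T -> 'rV[R]_n -> \bar R) :=
  forall d' (S : measurableType d') (t : S -> T) (g : S -> 'rV[R]_n),
    measurable_fun setT t -> row_measurable g ->
    measurable_fun setT (fun s => F (t s) (g s)).

Definition Borel n (f : 'rV[R]_n -> \bar R) :=
  forall d (S : measurableType d) (g : S -> 'rV[R]_n),
    row_measurable g -> measurable_fun setT (f \o g).

Lemma extend_rowD n (x y : 'rV[R]_n) s t :
  extend_row (x + y) (s + t) = extend_row x s + extend_row y t.
Proof. by apply/rowP => i; rewrite !mxE; case: unliftP => [j|] _; rewrite ?mxE. Qed.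

Lemma extend_rowZ n (x : 'rV[R]_n) a t :
  extend_row (a *: x) (a * t) = a *: extend_row x t.
Proof. by apply/rowP => i; rewrite !mxE; case: unliftP => [j|] _; rewrite ?mxE. Qed.

Lemma extend_row_surj n (x : 'rV[R]_n.+1) :
  exists y t, x = extend_row y t.
Proof.
exists (\row_j x 0 (lift ord_max j)), (x 0 ord_max).
by apply/rowP => i; rewrite !mxE; case: unliftP => [j|] ->; rewrite ?mxE.
Qed.

Lemma row_measurable_extend d (S : measurableType d) n (g : S -> 'rV[R]_n) (t : S -> R) :
  row_measurable g -> measurable_fun setT t ->
  row_measurable (fun s => extend_row (g s) (t s)).
Proof.
move=> mg mt i; case: (unliftP ord_max i) => [j|] ->.
- by apply: eq_measurable_fun (mg j) => s _; rewrite mxE liftK.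
- by apply: eq_measurable_fun mt => s _; rewrite mxE unlift_none.
Qed.

Lemma row_measurableD d (S : measurableType d) n (g h : S -> 'rV[R]_n) :
  row_measurable g -> row_measurable h -> row_measurable (fun s => g s + h s).
Proof.
move=> mg mh i; apply: eq_measurable_fun (measurable_funD (mg i) (mh i)) => s _.
by rewrite mxE.
Qed.

Lemma row_measurableZ d (S : measurableType d) n (a : S -> R) (g : S -> 'rV[R]_n) :
  measurable_fun setT a -> row_measurable g -> row_measurable (fun s => a s *: g s).
Proof.
move=> ma mg i; apply: eq_measurable_fun (measurable_funM ma (mg i)) => s _.
by rewrite mxE.
Qed.

Lemma row_measurable_cst d (S : measurableType d) n (x : 'rV[R]_n) :
  row_measurable (fun _ : S => x).
Proof. by move=> i; exact: measurable_cst. Qed.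

Lemma Borel_comp_param d (T : measurableType d) n (F : T -> 'rV[R]_n -> \bar R) t :
  Borel_param F -> Borel (F t).
Proof. by move=> mF d' S g mg; apply: (mF _ _ (fun=> t)). Qed.

Lemma Borel_slice n (f : 'rV[R]_n.+1 -> \bar R) :
  Borel f -> Borel_param (fun t : measurableTypeR R => fun y => f (extend_row y t)).
Proof. by move=> mf d' S t g mt mg; apply: mf; exact: row_measurable_extend. Qed.

Lemma Borel_line n (f : 'rV[R]_n -> \bar R) x u :
  Borel f -> measurable_fun [set: measurableTypeR R] (fun s : measurableTypeR R => f (x + s *: u)).
Proof.
move=> mf; apply: mf; apply: row_measurableD; first exact: row_measurable_cst.
by apply: row_measurableZ => //; exact: row_measurable_cst.
Qed.

Lemma iter_integral_ge0 n (f : 'rV[R]_n -> \bar R) :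
  (forall x, 0 <= f x)%E -> (0 <= iter_integral f)%E.
Proof.
elim: n f => [|n IH] f f0 /=; first exact: f0.
by apply: integral_ge0 => t _; exact: IH.
Qed.

(** The parameter space is arbitrary so that the induction can move the last coordinate into it: the
    induction hypothesis is used over [T * R], and Tonelli integrates that coordinate out. *)
Lemma measurable_iter_integral n d (T : measurableType d) (F : T -> 'rV[R]_n -> \bar R) :
  Borel_param F -> (forall t x, 0 <= F t x)%E ->
  measurable_fun setT (fun t => iter_integral (F t)).
Proof.
elim: n d T F => [|n IH] d T F mF F0 /=.
  by apply: (mF _ T id) => //; exact: row_measurable_cst.
pose G (p : T * measurableTypeR R) y := F p.1 (extend_row y p.2).
have mG : measurable_fun setT (fun p => iter_integral (G p)).
  apply: IH => [d' S t g mt mg|*]; last exact: F0.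
  apply: mF; first exact: measurableT_comp.
  by apply: row_measurable_extend => //; exact: measurableT_comp.
apply: (@measurable_fun_fubini_tonelli_F _ _ _ _ _ mu (fun p => iter_integral (G p)) mG).
by move=> p; apply: iter_integral_ge0 => x; exact: F0.
Qed.

Lemma le_iter_integral n (f g : 'rV[R]_n -> \bar R) :
  Borel f -> Borel g -> (forall x, 0 <= f x)%E -> (forall x, f x <= g x)%E ->
  (iter_integral f <= iter_integral g)%E.
Proof.
elim: n f g => [|n IH] f g mf mg f0 fg /=; first exact: fg.
have g0 x : (0 <= g x)%E by exact: le_trans (fg x).
apply: ge0_le_integral => //.
- by move=> t _; exact: iter_integral_ge0.
- by apply: measurable_iter_integral => //; exact: Borel_slice.
- by apply: measurable_iter_integral => //; exact: Borel_slice.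
- by move=> t _; apply: IH => //; apply: Borel_comp_param (Borel_slice _).
Qed.

Lemma iter_integralD n (f g : 'rV[R]_n -> \bar R) :
  Borel f -> Borel g -> (forall x, 0 <= f x)%E -> (forall x, 0 <= g x)%E ->
  iter_integral (fun x => f x + g x)%E = (iter_integral f + iter_integral g)%E.
Proof.
elim: n f g => [//|n IH] f g mf mg f0 g0 /=.
rewrite -ge0_integralD//.
- by apply: eq_integral => t _; apply: IH => //; apply: Borel_comp_param (Borel_slice _).
- by move=> t _; exact: iter_integral_ge0.
- by apply: measurable_iter_integral => //; exact: Borel_slice.
- by move=> t _; exact: iter_integral_ge0.
- by apply: measurable_iter_integral => //; exact: Borel_slice.
Qed.

Lemma iter_integral_tonelli n (F : measurableTypeR R -> 'rV[R]_n -> \bar R) :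
  Borel_param F -> (forall t x, 0 <= F t x)%E ->
  (\int[mu]_s iter_integral (F s) = iter_integral (fun x => \int[mu]_s F s x))%E.
Proof.
elim: n F => [//|n IH] F mF F0 /=.
pose G (p : measurableTypeR R * measurableTypeR R) y := F p.1 (extend_row y p.2).
have mG : measurable_fun setT (fun p => iter_integral (G p)).
  apply: measurable_iter_integral => [d' S t g mt mg|*]; last exact: F0.
  apply: mF; first exact: measurableT_comp.
  by apply: row_measurable_extend => //; exact: measurableT_comp.
rewrite (@fubini_tonelli _ _ _ _ _ mu mu (fun p => iter_integral (G p)) mG); last first.
  by move=> p; apply: iter_integral_ge0 => x; exact: F0.
apply: eq_integral => r _; rewrite -IH// => d' S t g mt mg.
by apply: mF => //; apply: row_measurable_extend => //; exact: measurable_cst.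
Qed.

Lemma iter_integral_translate n (f : 'rV[R]_n -> \bar R) (w : 'rV[R]_n) :
  Borel f -> (forall x, 0 <= f x)%E ->
  iter_integral (fun x => f (x + w)) = iter_integral f.
Proof.
elim: n f w => [|n IH] f w mf f0 /=; first by rewrite (thinmx0 w) addr0.
have [v [c ->]] := extend_row_surj w.
transitivity (\int[mu]_t iter_integral (fun y => f (extend_row y (t + c)%R)))%E.
  apply: eq_integral => t _.
  rewrite -(IH (fun y => f (extend_row y (t + c))) v)//.
    by congr iter_integral; apply/funext => y; rewrite extend_rowD.
  exact: (Borel_comp_param (T := measurableTypeR R)) (Borel_slice mf).
apply: (@ge0_integral_shift R c (fun t => iter_integral (fun y => f (extend_row y t)))).
  by apply: (measurable_iter_integral (T := measurableTypeR R)) => //; exact: Borel_slice.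
by move=> t; exact: iter_integral_ge0.
Qed.

(* Cavalieri's principle along an arbitrary direction: when the last coordinate
   of [u] does not vanish, a shear makes the last axis parallel to [u];
   otherwise one argues slice by slice. *)
Lemma le_iter_integral_lines n (u : 'rV[R]_n) (f g : 'rV[R]_n -> \bar R) :
  u != 0 -> Borel f -> Borel g -> (forall x, 0 <= f x)%E -> (forall x, 0 <= g x)%E ->
  (forall x, \int[mu]_s f (x + s *: u)%R <= \int[mu]_s g (x + s *: u)%R)%E ->
  (iter_integral f <= iter_integral g)%E.
Proof.
elim: n u f g => [|n IH] u f g u0 mf mg f0 g0 fg; first by rewrite (thinmx0 u) eqxx in u0.
have [w [c uE]] := extend_row_surj u.
have [c0|c0] := eqVneq c 0.
  have w0 : w != 0.
    apply: contraNneq u0 => w0; apply/eqP; rewrite uE c0 w0.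
    by apply/rowP => i; rewrite !mxE; case: unliftP => [j|] _; rewrite ?mxE.
  rewrite /=; apply: ge0_le_integral => //.
  - by move=> t _; exact: iter_integral_ge0.
  - by apply: measurable_iter_integral => //; exact: Borel_slice.
  - by apply: measurable_iter_integral => //; exact: Borel_slice.
  - move=> t _; apply: (IH w) => //; try by apply: Borel_comp_param (Borel_slice _).
    move=> x; have := fg (extend_row x t).
    have E s : extend_row (x + s *: w) t = extend_row x t + s *: u.
      by rewrite uE -extend_rowZ -extend_rowD c0 mulr0 addr0.
    by under eq_integral do rewrite -E; under [X in (_ <= X)%E -> _]eq_integral do rewrite -E.
(* Translating the slice at height [s] by (s/c) [w] keeps its integral. After exchanging the
   integrals, the inner variable runs through the points (y,0) + (s/c) [u]; rescaling it gives the
   factor |c|, the same for [f] and [g]. *)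
have shear (h : 'rV[R]_n.+1 -> \bar R) : Borel h -> (forall x, 0 <= h x)%E ->
    iter_integral h =
    iter_integral (fun y => (`|c^-1|^-1)%:E * \int[mu]_s h (extend_row y 0 + s *: u)%R)%E.
  move=> mh h0 /=.
  transitivity (\int[mu]_s iter_integral
      (fun y => h (extend_row (y + (c^-1 * s) *: w)%R s)))%E.
    apply: eq_integral => s _.
    rewrite (@iter_integral_translate _ (fun y => h (extend_row y s)))//.
    exact: (Borel_comp_param (T := measurableTypeR R)) (Borel_slice mh).
  rewrite iter_integral_tonelli//; last first.
    move=> d' S t g' mt mg'; apply: mh; apply: row_measurable_extend => //.
    apply: row_measurableD => //; apply: row_measurableZ; last exact: row_measurable_cst.
    by apply: measurable_funM.
  congr iter_integral; apply/funext => y.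
  rewrite -(@ge0_integral_affine _ c^-1 0) ?invr_eq0//; last exact: Borel_line.
  apply: eq_integral => s _; congr h.
  by rewrite addr0 uE -extend_rowZ -extend_rowD add0r mulrAC mulVf// mul1r.
have mline (h : 'rV[R]_n.+1 -> \bar R) : Borel h -> (forall x, 0 <= h x)%E ->
    Borel (fun y : 'rV[R]_n => (`|c^-1|^-1)%:E * \int[mu]_s h (extend_row y 0 + s *: u)%R)%E.
  move=> mh h0 d S g' mg'; apply: measurable_funeM.
  apply: (@measurable_fun_fubini_tonelli_F _ _ S _ _ mu
    (fun p : S * measurableTypeR R => h (extend_row (g' p.1) 0 + p.2 *: u)%R)) => //.
  apply: mh; apply: row_measurableD.
    apply: row_measurable_extend; last exact: measurable_cst.
    by move=> i; exact: (measurableT_comp (mg' i)).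
  by apply: row_measurableZ => //; exact: row_measurable_cst.
have k0 : (0 <= (`|c^-1|^-1)%:E)%E by rewrite lee_fin invr_ge0.
rewrite !shear//; apply: le_iter_integral; [exact: mline|exact: mline| |].
- by move=> x; apply: mule_ge0 => //; exact: integral_ge0.
- by move=> x; apply: lee_pmul => //; exact: integral_ge0.
Qed.

(** Cubes are the only sets whose volume is computed: they bound the volume of a bounded set, and
    they supply the positive gain in the strict case. *)
Lemma iter_integral_cube n (p : 'rV[R]_n) (e : R) : 0 < e ->
  iter_integral (fun x => (\1_[set x | forall i, `|x 0 i - p 0 i| <= e] x)%:E) =
  ((2 * e) ^+ n)%:E.
Proof.
move=> e0; elim: n p => [|n IH] p.
  by rewrite /= indicE mem_set//= => -[].
have [q [c ->]] := extend_row_surj p.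
transitivity (\int[mu]_(t in `[(c - e)%R, (c + e)%R]%classic) (((2 * e) ^+ n)%R)%:E)%E.
  rewrite [RHS]integral_mkcond /=; apply: eq_integral => t _.
  rewrite patchE; case: ifPn => [|]; rewrite ?inE /= ?notin_setE /= in_itv/= -ler_distl.
    move=> ct; rewrite -(IH q); congr iter_integral; apply/funext => y; congr (_%:E).
    rewrite !indicE; congr (_%:R); congr nat_of_bool; apply/idP/idP; rewrite !inE /=.
      by move=> h i; have := h (lift ord_max i); rewrite !mxE liftK.
    by move=> h i; rewrite !mxE; case: unliftP => [j|] _; [exact: h|exact: ct].
  move=> ct; rewrite (_ : (fun y => _) = fun=> 0%E); last first.
    apply/funext => y; rewrite indicE memNset//= => /(_ ord_max).
    by rewrite !mxE unlift_none => ?; exact: ct.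
  by clear; elim: n => [//|n IHn] /=; rewrite integral0_eq.
have muI : mu `[(c - e)%R, (c + e)%R]%classic = (2 * e)%:E.
  rewrite lebesgue_measure_itv/= lte_fin ltrD2l gtrN// -EFinD.
  by congr EFin; ring.
by rewrite integral_cst//= muI -EFinM exprSr.
Qed.

End IteratedIntegral.

(** * Inner product, and measurability of closed sets of row vectors *)

Section RowTopology.
Variables (R : realType) (n : nat).
Implicit Types (x y z u : 'rV[R]_n) (K : set 'rV[R]_n).

Lemma edotC x y : edot x y = edot y x.
Proof. by apply: eq_bigr => i _; rewrite mulrC. Qed.

Lemma edotDl x y z : edot (x + y) z = edot x z + edot y z.
Proof. by rewrite -big_split; apply: eq_bigr => i _; rewrite mxE mulrDl. Qed.

Lemma edotZl (a : R) x z : edot (a *: x) z = a * edot x z.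
Proof. by rewrite mulr_sumr; apply: eq_bigr => i _; rewrite mxE mulrA. Qed.

Lemma edotDr x y z : edot x (y + z) = edot x y + edot x z.
Proof. by rewrite edotC edotDl !(edotC _ x). Qed.

Lemma edotZr (a : R) x z : edot x (a *: z) = a * edot x z.
Proof. by rewrite edotC edotZl edotC. Qed.

Lemma edotNl x z : edot (- x) z = - edot x z.
Proof. by rewrite -scaleN1r edotZl mulN1r. Qed.

Lemma edot_ge0 x : 0 <= edot x x.
Proof. by apply: sumr_ge0 => i _; rewrite -expr2 sqr_ge0. Qed.

Lemma edot_eq0 x : (edot x x == 0) = (x == 0).
Proof.
apply/idP/eqP => [|->]; last by rewrite /edot big1// => i _; rewrite mxE mul0r.
rewrite psumr_eq0 => [/allP h|i _]; last by rewrite -expr2 sqr_ge0.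
apply/rowP => i; rewrite mxE; apply/eqP.
by have := h i (mem_index_enum i); rewrite /= mulf_eq0 orbb.
Qed.

Lemma eballE r x : 0 <= r -> eball r x <-> edot x x <= r ^+ 2.
Proof.
move=> r0; rewrite /eball /= /enorm.
by rewrite -[in X in _ <-> X](sqr_sqrtr (edot_ge0 x)) ler_sqr// nnegrE sqrtr_ge0.
Qed.

Lemma continuous_edot (T : topologicalType) (f g : T -> 'rV[R]_n) :
  continuous f -> continuous g -> continuous (fun t => edot (f t) (g t)).
Proof.
move=> cf cg; apply: continuous_big => [|i _ t]; first exact: add_continuous.
apply: (@continuousM _ _ (fun t => f t 0 i) (fun t => g t 0 i)).
- by apply: (@continuous_comp _ _ _ f (fun x : 'rV[R]_n => x 0 i)); [exact: cf|exact: coord_continuous].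
- by apply: (@continuous_comp _ _ _ g (fun x : 'rV[R]_n => x 0 i)); [exact: cg|exact: coord_continuous].
Qed.

Lemma ball_coord x y e i : ball x e y -> `|x 0 i - y 0 i| < e.
Proof. by case=> _ /(_ 0 i). Qed.

(** The open complement is a union of countably many rational boxes, and the preimage of a box is a
    finite intersection of conditions on single coordinates. *)
Lemma row_measurable_closed d (S : measurableType d) (g : S -> 'rV[R]_n) K :
  closed K -> row_measurable g -> measurable (g @^-1` K).
Proof.
move=> cK mg.
suff : measurable (g @^-1` (~` K)) by rewrite preimage_setC => /measurableC; rewrite setCK.
pose box (q : 'rV[rat]_n * nat) : set 'rV[R]_n :=
  [set x | forall i, `|x 0 i - ratr (q.1 0 i)| < q.2.+1%:R^-1].
pose good q := box q `<=` ~` K.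
have -> : g @^-1` (~` K) = \bigcup_q (if `[< good q >] then g @^-1` box q else set0).
  apply/seteqP; split=> s /=; last first.
    by move=> [q _]; case: asboolP => // gq; exact: gq.
  move=> Ks; have oK : nbhs (g s) (~` K) by apply: open_nbhs_nbhs; split => //; exact: closed_openC.
  have [e /= e0 eK] := (nbhs_ballP _ _).1 oK.
  (* A box of half-width 1/(k+1) < e/2 whose centre is that close to [g s] contains [g s] and stays
     within [e] of it. *)
  have e20 : 0 < e / 2 by rewrite divr_gt0.
  have [k _ /(_ k (leqnn k)) ke] := near_infty_natSinv_lt (PosNum e20).
  have k0 : 0 < k.+1%:R^-1 :> R by rewrite invr_gt0.
  have /choice [q qP] i : exists q : rat, `|g s 0 i - ratr q| < k.+1%:R^-1.
    have [|q] := @rat_in_itvoo R (g s 0 i - k.+1%:R^-1) (g s 0 i + k.+1%:R^-1).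
      by rewrite ltrBlDr -addrA ltrDl addr_gt0.
    by rewrite in_itv/= -ltr_distl => h; exists q; rewrite distrC.
  exists (\row_i q i, k) => //=; case: asboolP => [_|].
    by rewrite /box /= => i; rewrite mxE.
  move=> []; rewrite /good => x /= bx; apply: eK; split => // i j.
  rewrite (ord1 i) /ball/= /ball_.
  have := qP j; have := bx j; rewrite mxE /= => h1 h2.
  rewrite (le_lt_trans (ler_distD (ratr (q j)) _ _))// (distrC _ (x 0 j)).
  by rewrite [e]splitr ltrD// (lt_trans _ ke).
refine (@countable_bigcupT_measurable _ S _ _ (countableP _) _); move=> q; case: asboolP => _ //.
have -> : g @^-1` box q = \bigcap_(i in [set: 'I_n]) [set s | `|g s 0 i - ratr (q.1 0 i)| < q.2.+1%:R^-1].
  by apply/seteqP; split=> s /= h i; [move=> _|]; exact: h.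
apply: fin_bigcap_measurable => [|i _]; first exact: finite_finset.
have mD : measurable_fun setT (fun s => `|g s 0 i - ratr (q.1 0 i)| < q.2.+1%:R^-1).
  apply: measurable_fun_ltr => //.
  by apply: measurableT_comp => //; apply: measurable_funB => //; exact: mg.
by have := mD measurableT [set true] I; rewrite setTI.
Qed.

Lemma Borel_indic_closed K : closed K -> Borel (fun x => (\1_K x)%:E).
Proof.
move=> cK d S g mg; apply/measurable_EFinP.
by apply: (measurable_indic (U := g @^-1` K)); exact: row_measurable_closed.
Qed.

(** The radius is a parameter rather than a constant because the volume must be measurable as a
    function of it. *)
Lemma Borel_param_indic_eball K : closed K ->
  Borel_param (fun r : measurableTypeR R => fun x => (\1_(K `&` @eball R n r) x)%:E).
Proof.
move=> cK d S t g mt mg; apply/measurable_EFinP.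
apply: (measurable_indic (U := [set s | (K `&` eball (t s)) (g s)])).
apply: (@measurableI _ _ (g @^-1` K)); first exact: row_measurable_closed.
have mD : measurable_fun setT (fun s => enorm (g s) <= t s).
  apply: measurable_fun_ler => //.
  apply: measurableT_comp.
    by apply: continuous_measurable_fun; exact: sqrt_continuous.
  by apply: measurable_sum => i; exact: measurable_funM.
by have := mD measurableT [set true] I; rewrite setTI.
Qed.

Lemma closed_cube (p : 'rV[R]_n) (e : R) :
  closed [set x : 'rV[R]_n | forall i, `|x 0 i - p 0 i| <= e].
Proof.
have -> : [set x : 'rV[R]_n | forall i, `|x 0 i - p 0 i| <= e] =
    \bigcap_(i in [set: 'I_n])
      (fun x : 'rV[R]_n => x 0 i) @^-1` `[p 0 i - e, p 0 i + e]%classic.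
  by apply/seteqP; split=> x /= h i => [_|]; [|have := h i I]; rewrite /= in_itv /= -ler_distl.
apply: closed_bigI => i _; apply: closed_comp => [x _|]; first exact: coord_continuous.
exact: interval_closed.
Qed.

Lemma volume_eball_bounded K : bounded_set K -> closed K ->
  exists2 C, 0 <= C & forall r, (volume (K `&` @eball R n r) <= C%:E)%E.
Proof.
(* Boundedness gives a norm bound by any number above [M], here [|M| + 1]; the further unit places
   [K] inside an open ball, hence inside a cube. *)
move=> [M [_ KM]] cK; set M' := `|M| + 2.
have M'0 : 0 < M' by rewrite ltr_wpDl.
exists ((2 * M') ^+ n) => [|r]; first by rewrite exprn_ge0// mulr_ge0// ltW.
rewrite -(@iter_integral_cube R n 0 M' M'0); apply: le_iter_integral.
- exact: (Borel_comp_param (T := measurableTypeR R) r (Borel_param_indic_eball cK)).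
- by apply: Borel_indic_closed; exact: closed_cube.
- by move=> x; rewrite lee_fin.
- move=> x; rewrite lee_fin !indicE; case: (boolP (x \in K `&` _)) => //; rewrite inE => -[Kx _].
  rewrite mem_set// => i.
  have xM : `|x| <= `|M| + 1 by apply: KM => //; rewrite (le_lt_trans (ler_norm M))// ltrDl.
  have : ball (0 : 'rV[R]_n) M' x.
    by rewrite mx_norm_ball /ball_ /= sub0r normrN (le_lt_trans xM)// ltrD2l ltr1n.
  by move/ball_coord => /(_ i)/ltW; rewrite distrC.
Qed.

End RowTopology.

(** * Chords in direction [u] and compactness of the symmetrized set *)

Section Chords.
Variables (R : realType) (n : nat) (u : 'rV[R]_n).
Hypothesis uu : edot u u = 1.
Implicit Types (x y : 'rV[R]_n) (K : set 'rV[R]_n).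

Notation perp x := (x - edot x u *: u).
Notation chord K x := [set t : R | K (x + t *: u)].

Lemma edot_perp x : edot (perp x) u = 0.
Proof. by rewrite edotDl edotNl edotZl uu mulr1 subrr. Qed.

Lemma perp_ortho x t : edot x u = 0 -> perp (x + t *: u) = x.
Proof. by move=> xu; rewrite edotDl edotZl xu uu add0r mulr1 addrK. Qed.

Lemma edot_ortho x t : edot x u = 0 -> edot (x + t *: u) u = t.
Proof. by move=> xu; rewrite edotDl edotZl xu uu add0r mulr1. Qed.

Lemma sqr_edot_ortho x t : edot x u = 0 ->
  edot (x + t *: u) (x + t *: u) = edot x x + t ^+ 2.
Proof.
move=> xu; rewrite !edotDl !edotDr !edotZl !edotZr uu (edotC u x) xu.
by ring.
Qed.

Lemma continuous_edotl (T : topologicalType) (f : T -> 'rV[R]_n) :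
  continuous f -> continuous (fun t => edot (f t) u).
Proof. by move=> cf; apply: continuous_edot => // t; exact: cvg_cst. Qed.

Lemma continuous_edotu : continuous (fun x => edot x u).
Proof. by apply: (@continuous_edotl _ id) => y; exact: cvg_id. Qed.

Lemma continuous_scaleu (T : topologicalType) (f : T -> R) :
  continuous f -> continuous (fun t => f t *: u).
Proof. by move=> cf t; exact: (@cvgZr_tmp R 'rV[R]_n T (nbhs t) _ f (f t) u (cf t)). Qed.

Lemma continuous_rowD (T : topologicalType) (f g : T -> 'rV[R]_n) :
  continuous f -> continuous g -> continuous (fun t => f t + g t).
Proof. by move=> cf cg t; exact: (@cvgD R 'rV[R]_n T (nbhs t) _ f g _ _ (cf t) (cg t)). Qed.

Lemma continuous_rowB (T : topologicalType) (f g : T -> 'rV[R]_n) :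
  continuous f -> continuous g -> continuous (fun t => f t - g t).
Proof. by move=> cf cg t; exact: (@cvgB R 'rV[R]_n T (nbhs t) _ f g _ _ (cf t) (cg t)). Qed.

Lemma continuous_perp (T : topologicalType) (f : T -> 'rV[R]_n) :
  continuous f -> continuous (fun t => perp (f t)).
Proof.
by move=> cf; apply: continuous_rowB => //; apply: continuous_scaleu; exact: continuous_edotl.
Qed.

(** The line through [x] is the zero set of the continuous function |d|^2, hence closed; the chord
    is the image of its intersection with [K] under the height above [x]. *)
Lemma chord_compact K x : compact K -> compact (chord K x).
Proof.
move=> cK; pose d (y : 'rV[R]_n) : 'rV[R]_n := perp y - perp x.
have cid : continuous (fun y : 'rV[R]_n => y) by move=> y; exact: cvg_id.
have cd : continuous d.
  by apply: continuous_rowB; [exact: continuous_perp|exact: cst_continuous].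
have -> : chord K x = (fun y => edot (y - x) u) @` (K `&` [set y | edot (d y) (d y) = 0]).
  apply/seteqP; split=> [t /= Kt|_ [y [Ky /= /eqP dy] <-] /=].
    exists (x + t *: u) => /=; last by rewrite addrAC subrr add0r edotZl uu mulr1.
    split=> //; apply/eqP; rewrite edot_eq0 /d edotDl edotZl uu mulr1 scalerDl.
    by rewrite opprD addrACA subrr addr0 subrr.
  move: dy; rewrite edot_eq0 subr_eq0 => /eqP e.
  by rewrite edotDl edotNl scalerBl addrCA -e subrKC.
apply: continuous_compact.
  apply: continuous_subspaceT; apply: continuous_edotl.
  by apply: continuous_rowB => //; exact: cst_continuous.
apply: compact_closedI => //.
apply: (@closed_comp _ _ (fun y => edot (d y) (d y)) [set z | z = 0]) => [y _|].
  exact: continuous_edot.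
exact: closed_eq.
Qed.

Lemma chordE K x : compact K -> convex_set_rV K -> chord K x !=set0 ->
  exists a b, [/\ a <= b, chord K x = `[a, b]%classic & chord_length u K x = b - a].
Proof.
move=> cK vK J0; have cJ := @chord_compact K x cK.
have [b /set_mem Jb bmax] := @compact_EVT_max _ R id _ J0 cJ (continuous_subspaceT (fun=> cvg_id)).
have [a /set_mem Ja amin] := @compact_EVT_min _ R id _ J0 cJ (continuous_subspaceT (fun=> cvg_id)).
have ab : a <= b by apply: amin; rewrite inE.
have JE : chord K x = `[a, b]%classic.
  apply/seteqP; split=> t /=; rewrite in_itv /=.
    by move=> Jt; apply/andP; split; [apply: amin|apply: bmax]; rewrite inE.
  move=> /andP[at_ tb]; have [ab0|ab0] := eqVneq a b.
    by have -> : t = a by apply: le_anti; rewrite at_ ab0 tb.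
  have ltab : a < b by rewrite lt_neqAle ab0.
  pose l := (b - t) / (b - a).
  have := vK _ _ Ja Jb l; have -> : x + t *: u = l *: (x + a *: u) + (1 - l) *: (x + b *: u).
    rewrite !scalerDr addrACA -scalerDl subrKC scale1r; congr (_ + _).
    rewrite !scalerA -scalerDl; congr (_ *: _); rewrite /l; field.
    by rewrite subr_eq0 eq_sym.
  apply; rewrite divr_ge0 ?subr_ge0//= ler_pdivrMr ?subr_gt0// mul1r; lra.
by exists a, b; split => //; rewrite /chord_length JE sup_itvcc// inf_itvcc.
Qed.

(** Nonemptiness must be stated: on an empty chord [sup] and [inf] both default to 0, and the length
    condition alone would admit t = 0. *)
Lemma steiner_chord K x t : edot x u = 0 ->
  steiner u K (x + t *: u) <-> chord K x !=set0 /\ `|t| <= chord_length u K x / 2.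
Proof.
move=> xu; split=> [[x' [t' [[y Ky yx'] [t'L e]]]]|[[s Ks] tL]].
  have x'u : edot x' u = 0 by rewrite -yx' edot_perp.
  have tt' : t = t' by rewrite -(edot_ortho t xu) e edot_ortho.
  have xx' : x = x' by rewrite -(perp_ortho t xu) e perp_ortho.
  rewrite xx' tt'; split => //; exists (edot y u) => /=.
  by rewrite -yx' subrK.
exists x, t; split => //; exists (x + s *: u) => //; exact: perp_ortho.
Qed.

Lemma row_decomp x : x = perp x + edot x u *: u.
Proof. by rewrite subrK. Qed.

Lemma chord_perp K x : K x -> chord K (perp x) (edot x u).
Proof. by move=> Kx /=; rewrite subrK. Qed.

(** The symmetrized set is a continuous image of a compact set of triples: two points [p], [q] of
    [K] on a common line parallel to [u], and a factor [s] in [-1/2, 1/2] applied to their signed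
    distance. This avoids any semicontinuity of the chord length. *)
Lemma compact_steiner K : compact K -> convex_set_rV K -> compact (steiner u K).
Proof.
move=> cK vK.
pose d (z : 'rV[R]_n * 'rV[R]_n * R) := perp z.1.1 - perp z.1.2.
pose h (z : 'rV[R]_n * 'rV[R]_n * R) :=
  perp z.1.1 + (z.2 * edot (z.1.1 - z.1.2) u) *: u.
have c1 : continuous (fun z : 'rV[R]_n * 'rV[R]_n * R => z.1.1).
  by move=> z; apply: (@continuous_comp _ _ _ fst fst); exact: cvg_fst.
have c2 : continuous (fun z : 'rV[R]_n * 'rV[R]_n * R => z.1.2).
  by move=> z; apply: (@continuous_comp _ _ _ fst snd); [exact: cvg_fst|exact: cvg_snd].
have cd : continuous d by apply: continuous_rowB; exact: continuous_perp.
have ch : continuous h.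
  apply: continuous_rowD; first exact: continuous_perp.
  pose e (z : 'rV[R]_n * 'rV[R]_n * R) := edot (z.1.1 - z.1.2) u.
  have ce : continuous e by apply: continuous_edotl; exact: continuous_rowB.
  apply: (continuous_scaleu (f := (fun z => z.2) \* e)) => z.
  by apply: continuousM; [exact: cvg_snd|exact: ce].
have -> : steiner u K = h @` (((K `*` K) `*` `[- (1 / 2), 1 / 2]%classic) `&`
    [set z | edot (d z) (d z) = 0]).
  apply/seteqP; split=> [y|_ [[[p q] s] [[[/= Kp Kq] sI] /= /eqP dz] <-]].
    rewrite {1}(row_decomp y) steiner_chord ?edot_perp// => -[J0 yL].
    have [a [b [ab JE LE]]] := chordE cK vK J0.
    have Ja : K (perp y + a *: u) by have : chord K (perp y) a by rewrite JE /= in_itv/= lexx.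
    have Jb : K (perp y + b *: u) by have : chord K (perp y) b by rewrite JE /= in_itv/= lexx ab.
    rewrite LE in yL; set t := edot y u in yL *.
    have yu := edot_perp y.
    (* The two ends of the chord realise its full length. If a = b the quotient is 0 by convention,
       and the bound [yL] forces t = 0 as well. *)
    exists (perp y + b *: u, perp y + a *: u, t / (b - a)) => /=.
      split; last by apply/eqP; rewrite edot_eq0 /d /= !perp_ortho// subrr.
      split; first by split.
      rewrite /= in_itv /= -ler_norml normrM normfV (ger0_norm (x := b - a)) ?subr_ge0//.
      have [->|ab0] := eqVneq a b; first by rewrite subrr invr0 mulr0 divr_ge0.
      have ltab : a < b by rewrite lt_neqAle ab0.
      by rewrite ler_pdivrMr ?subr_gt0// (le_trans yL)//; lra.
    rewrite /h /= perp_ortho// edotDl edotNl !edot_ortho// [RHS](row_decomp y); congr (_ + _ *: _).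
    have [e|ab0] := eqVneq a b.
      move: yL; rewrite e subrr mul0r normr_le0 => /eqP t0.
      by rewrite -/t t0 mul0r mul0r.
    by rewrite divfK// subr_eq0 eq_sym.
  move: dz; rewrite edot_eq0 /d /= subr_eq0 => /eqP pq.
  rewrite /h /= edotDl edotNl steiner_chord ?edot_perp//.
  have Jp := chord_perp Kp; have := chord_perp Kq; rewrite -pq => Jq.
  have J0 : chord K (perp p) !=set0 by exists (edot p u).
  split=> //; have [a [b [ab JE ->]]] := chordE cK vK J0.
  move: Jp Jq; rewrite JE /= !in_itv /= => /andP[p1 p2] /andP[q1 q2].
  have pqab : `|edot p u - edot q u| <= b - a by rewrite ler_norml; apply/andP; split; lra.
  rewrite normrM mulrC ler_pM//.
  by move: sI; rewrite /= in_itv /= -ler_norml mul1r.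
apply: continuous_compact; first exact: continuous_subspaceT.
apply: compact_closedI.
  by apply: compact_setX; [exact: compact_setX|exact: segment_compact].
have ced : continuous (fun z => edot (d z) (d z)) by exact: continuous_edot.
by apply: (preimage_closed _ (@closed_eq R 0)) => z _; exact: ced.
Qed.

(** A chord closed under t -> -t is already centred. The contrapositive is what serves later: it
    yields a point of [K] whose mirror image is missing. *)
Lemma steiner_id K : compact K -> convex_set_rV K ->
  (forall y, K y -> K (y - (2 * edot y u) *: u)) -> steiner u K = K.
Proof.
move=> cK vK sym.
have symJ x t : edot x u = 0 -> chord K x t -> chord K x (- t).
  move=> xu /= /sym; rewrite edot_ortho// -addrA -scalerBl.
  by have -> : t - 2 * t = - t by ring.
have sym_itv x a b : edot x u = 0 -> chord K x = `[a, b]%classic -> a <= b -> a = - b.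
  move=> xu JE ab; apply: le_anti; apply/andP; split.
    by have := @symJ x b xu; rewrite JE /= !in_itv /= lexx ab => /(_ isT)/andP[].
  by have := @symJ x a xu; rewrite JE /= !in_itv /= lexx ab lerNl => /(_ isT)/andP[].
apply/seteqP; split=> y.
  rewrite {1}(row_decomp y) steiner_chord ?edot_perp// => -[J0 yL].
  have [a [b [ab JE LE]]] := chordE cK vK J0.
  have aE := sym_itv _ _ _ (edot_perp y) JE ab.
  have : chord K (perp y) (edot y u).
    by rewrite JE /= in_itv/= aE -ler_norml (le_trans yL)// LE aE; lra.
  by rewrite /= subrK.
move=> Ky; rewrite (row_decomp y) steiner_chord ?edot_perp//.
have Jy := chord_perp Ky; have J0 : chord K (perp y) !=set0 by exists (edot y u).
split=> //; have [a [b [ab JE ->]]] := chordE cK vK J0.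
have aE := sym_itv _ _ _ (edot_perp y) JE ab.
by move: Jy; rewrite JE /= in_itv/= aE -ler_norml => /le_trans; apply; lra.
Qed.

End Chords.

(** * The comparison on a single line, with and without a definite gain *)

Section LineInequality.
Variables (R : realType) (n : nat) (u : 'rV[R]_n).
Hypothesis uu : edot u u = 1.
Implicit Types (x y : 'rV[R]_n) (K : set 'rV[R]_n).
Notation mu := (@lebesgue_measure R).
Notation perp x := (x - edot x u *: u).
Notation chord K x := [set t : R | K (x + t *: u)].
Notation line_integral f x := (\int[mu]_s f (x + s *: u)%R)%E.

Lemma line_integral_perp (f : 'rV[R]_n -> \bar R) x : Borel f -> (forall x, 0 <= f x)%E ->
  line_integral f x = line_integral f (perp x).
Proof.
move=> mf f0.
rewrite -(@ge0_integral_shift R (edot x u) (fun s => f (perp x + s *: u)))//.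
  by apply: eq_integral => s _; rewrite scalerDl addrA addrAC subrK.
exact: Borel_line.
Qed.

(** The maximum with 0 covers b < a, which occurs when the ball misses the chord. *)
Lemma line_integral_itv (A : set 'rV[R]_n) x (a b : R) :
  chord A x = `[a, b]%classic ->
  line_integral (fun y => (\1_A y)%:E) x = (Num.max 0 (b - a))%:E.
Proof.
move=> AE; pose I : set R := `[a, b]%classic.
transitivity (\int[mu]_s (\1_I s)%:E)%E.
  by apply: eq_integral => s _; rewrite /I -AE !indicE.
rewrite integral_indic ?setIT//; last exact: measurable_itv.
have muI : mu I = (if (a < b)%R then b%:E - a%:E else 0)%E.
  by rewrite lebesgue_measure_itv/= lte_fin.
rewrite [LHS]muI.
by case: ltP => ab; [rewrite max_r// subr_ge0 ltW|rewrite max_l// subr_le0].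
Qed.

Lemma line_integral_set0 (A : set 'rV[R]_n) x :
  ~ (chord A x !=set0) -> line_integral (fun y => (\1_A y)%:E) x = 0%E.
Proof.
move=> A0; apply: integral0_eq => s _; rewrite indicE memNset// => As.
by apply: A0; exists s.
Qed.

Lemma line_integral_indic_ge0 (A : set 'rV[R]_n) x :
  (0 <= line_integral (fun y => (\1_A y)%:E) x)%E.
Proof. by apply: integral_ge0 => s _; rewrite lee_fin. Qed.

Lemma chord_eball x r s : edot x u = 0 -> 0 <= r -> edot x x <= r ^+ 2 ->
  eball r (x + s *: u) <-> `|s| <= Num.sqrt (r ^+ 2 - edot x x).
Proof.
move=> xu r0 xr; rewrite eballE// sqr_edot_ortho// -sqrtr_sqr ler_sqrt ?subr_ge0//.
by rewrite lerBrDl.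
Qed.

Lemma chord_eball_eq0 K x r : edot x u = 0 -> 0 <= r -> r ^+ 2 < edot x x ->
  ~ (chord (K `&` eball r) x !=set0).
Proof.
move=> xu r0 xr [s /= [_]]; rewrite eballE// sqr_edot_ortho//.
by apply/negP; rewrite -ltNge ltr_wpDr// sqr_ge0.
Qed.

Lemma chord_setI_eball K x r a b : edot x u = 0 -> 0 <= r -> edot x x <= r ^+ 2 ->
  chord K x = `[a, b]%classic ->
  chord (K `&` eball r) x =
  `[Num.max a (- Num.sqrt (r ^+ 2 - edot x x)), Num.min b (Num.sqrt (r ^+ 2 - edot x x))]%classic.
Proof.
move=> xu r0 xr JE; apply/seteqP; split=> s /=.
  move=> [Ks /(chord_eball _ xu r0 xr)]; rewrite ler_norml => /andP[h1 h2].
  have : chord K x s by []; rewrite JE /= !in_itv /= => /andP[h3 h4].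
  by rewrite ge_max le_min h1 h2 h3 h4.
rewrite in_itv /= ge_max le_min => /andP[/andP[h1 h2] /andP[h3 h4]]; split.
  by have : chord K x s by rewrite JE /= in_itv /= h1 h3.
by apply/(chord_eball _ xu r0 xr); rewrite ler_norml h2 h4.
Qed.

Lemma chord_steiner_eball K x r a b : edot x u = 0 -> 0 <= r -> edot x x <= r ^+ 2 ->
  chord K x !=set0 -> chord_length u K x = b - a ->
  chord (steiner u K `&` eball r) x =
  `[- Num.min ((b - a) / 2) (Num.sqrt (r ^+ 2 - edot x x)),
    Num.min ((b - a) / 2) (Num.sqrt (r ^+ 2 - edot x x))]%classic.
Proof.
move=> xu r0 xr J0 LE; apply/seteqP; split=> s /=; rewrite in_itv /= -ler_norml le_min.
  by move=> [/(steiner_chord uu _ _ xu)[_]]; rewrite LE => -> /(chord_eball _ xu r0 xr).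
move=> /andP[h1 h2]; split; last exact/(chord_eball _ xu r0 xr).
by apply/(steiner_chord uu _ _ xu); rewrite LE.
Qed.

(** The right side is the smaller of b - a and 2m, the lengths of the two intervals whose
    intersection is measured on the left. *)
Lemma centered_interval_le (a b m : R) : a <= b -> 0 <= m ->
  Num.max 0 (Num.min b m - Num.max a (- m)) <=
  Num.max 0 (Num.min ((b - a) / 2) m - - Num.min ((b - a) / 2) m).
Proof.
move=> ab m0; case: (leP a (- m)) => h1; case: (leP b m) => h2; case: (leP ((b - a) / 2) m) => h3;
  by rewrite ge_max !le_max lexx /=; apply/orP; right; lra.
Qed.

(** Here [a, b] meets [-m, m] exactly in [a, m]. Both b - a and 2m exceed m - a by at least d - eta,
    one [eta] being lost to the distance of [m] from [s]; so 3 eta <= d leaves a gain of 2 eta. *)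
Lemma centered_interval_gap_pos (a b m s d eta : R) : 0 < eta -> 3 * eta <= d -> 0 < s ->
  `|m - s| <= eta -> a <= s - d -> s + d <= b -> - s + d < a \/ b < - s + d ->
  Num.max 0 (Num.min b m - Num.max a (- m)) + 2 * eta <=
  Num.max 0 (Num.min ((b - a) / 2) m - - Num.min ((b - a) / 2) m).
Proof.
move=> e0 ed s0; rewrite ler_norml => /andP[ms1 ms2] asd sdb h.
have {}h : - s + d < a by case: h => // h; lra.
rewrite (max_l (x := a)) ?(min_r (x := b)); [|lra|lra].
rewrite (max_r (y := m - a)); last by lra.
by rewrite le_max; apply/orP; right; case: (leP ((b - a) / 2) m) => h3; lra.
Qed.

Lemma centered_interval_gap (a b m s d eta : R) : 0 < eta -> 3 * eta <= d -> s != 0 ->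
  `|m - `|s| | <= eta -> a <= s - d -> s + d <= b ->
  (forall t, `|t| <= d -> ~ (a <= - (s + t) <= b)) ->
  Num.max 0 (Num.min b m - Num.max a (- m)) + 2 * eta <=
  Num.max 0 (Num.min ((b - a) / 2) m - - Num.min ((b - a) / 2) m).
Proof.
move=> e0 ed s0 ms asd sdb h.
have d0 : 0 <= d by lra.
have [sp|sn|se] := ltgtP 0 s; last by rewrite se eqxx in s0.
  apply: (@centered_interval_gap_pos _ _ _ s d) => //; first by rewrite -{1}(gtr0_norm sp).
  (* The point -s + d lies below [b], so its absence from [a, b] puts it below [a]. *)
  left; rewrite ltNge; apply/negP => ha; apply: (h (- d)); first by rewrite normrN ger0_norm.
  by apply/andP; split; lra.
(* For negative [s], replace [a, b] by [-b, -a]; neither length changes. *)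
have -> : Num.min b m - Num.max a (- m) = Num.min (- a) m - Num.max (- b) (- m).
  by rewrite !oppr_max !opprK addrC.
have -> : b - a = - a - - b by ring.
apply: (@centered_interval_gap_pos _ _ _ (- s) d) => //; try lra.
  by rewrite -(ltr0_norm sn).
left; rewrite ltNge; apply/negP => hb; apply: (h d); first by rewrite ger0_norm.
by apply/andP; split; lra.
Qed.

Lemma line_integral_steiner K r x : compact K -> convex_set_rV K -> 0 <= r ->
  (line_integral (fun y => (\1_(K `&` eball r) y)%:E) x <=
   line_integral (fun y => (\1_(steiner u K `&` eball r) y)%:E) x)%E.
Proof.
move=> cK vK r0; have cS := compact_steiner uu cK vK.
have hd := @norm_hausdorff R 'rV[R]_n.
have B K' : compact K' -> Borel (fun y => (\1_(K' `&` @eball R n r) y)%:E).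
  move=> /(compact_closed hd) cK'.
  exact: (Borel_comp_param (T := measurableTypeR R) r (Borel_param_indic_eball cK')).
rewrite (@line_integral_perp (fun y => (\1_(K `&` eball r) y)%:E)); [|exact: B|by move=> y; rewrite lee_fin].
rewrite (@line_integral_perp (fun y => (\1_(steiner u K `&` eball r) y)%:E)); [|exact: B|by move=> y; rewrite lee_fin].
have xu := edot_perp uu x; set z := perp x in xu *.
have [zr|rz] := leP (edot z z) (r ^+ 2); last first.
  by rewrite line_integral_set0 ?line_integral_indic_ge0//; exact: chord_eball_eq0.
have [J0|J0] := pselect (chord K z !=set0); last first.
  rewrite line_integral_set0 ?line_integral_indic_ge0// => -[s [Ks _]].
  by apply: J0; exists s.
have [a [b [ab JE LE]]] := chordE uu cK vK J0.
rewrite (line_integral_itv (chord_setI_eball xu r0 zr JE)).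
rewrite (line_integral_itv (chord_steiner_eball xu r0 zr J0 LE)) lee_fin.
by apply: centered_interval_le => //; exact: sqrtr_ge0.
Qed.

(** Factor q - s^2 as (sqrt q - s)(sqrt q + s). Since s >= c/2, the second factor is at least c/2,
    and 2 kappa <= (c/2) eta. *)
Lemma sqrt_dist_le (s q c eta kappa : R) : 0 < eta -> 2 * eta <= c -> 4 * kappa <= c * eta ->
  0 <= s -> c - eta <= s -> `|q - s ^+ 2| <= 2 * kappa -> `|Num.sqrt q - s| <= eta.
Proof.
move=> e0 ec kc s0 cs; rewrite ler_norml => /andP[h1 h2].
have q0 : 0 <= q by nra.
have [m0 mm] := (sqrtr_ge0 q, sqr_sqrtr q0); set m := Num.sqrt q in m0 mm *.
rewrite ler_norml; apply/andP; split; nra.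
Qed.

(* Near [p] and for [r] slightly above [enorm p], every chord through the cube
   loses at least [2 * eta] to the ball on the side of [p] and not on the
   opposite side, while symmetrizing the chord avoids this loss. *)
Lemma line_integral_steiner_gap K (p : 'rV[R]_n) (d e eta kappa r : R) x :
  compact K -> convex_set_rV K -> 0 < eta -> 3 * eta <= d ->
  2 * eta <= `|edot p u| -> 4 * kappa <= `|edot p u| * eta ->
  (forall y, (forall i, `|y 0 i - p 0 i| <= e) ->
    [/\ forall t, `|t| <= d ->
          K (y + t *: u) /\ ~ K (y + t *: u - (2 * edot (y + t *: u) u) *: u),
        `|edot y u - edot p u| <= eta & `|edot y y - edot p p| <= kappa]) ->
  0 <= r -> edot p p <= r ^+ 2 <= edot p p + kappa ->
  (line_integral (fun y => (\1_(K `&` eball r) y)%:E) x +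
   line_integral (fun y => (\1_[set y : 'rV[R]_n | forall i, (`|y 0 i - p 0 i| <= e)%R] y)%:E) x <=
   line_integral (fun y => (\1_(steiner u K `&` eball r) y)%:E) x)%E.
Proof.
move=> cK vK e0 ed ec kc Q r0 /andP[pr rp]; have cS := compact_steiner uu cK vK.
set cube := [set y | _].
have hd := @norm_hausdorff R 'rV[R]_n.
have [Q0|Q0] := pselect (chord cube x !=set0); last first.
  by rewrite (line_integral_set0 Q0) adde0; exact: line_integral_steiner.
have B K' : compact K' -> Borel (fun y => (\1_(K' `&` @eball R n r) y)%:E).
  move=> /(compact_closed hd) cK'.
  exact: (Borel_comp_param (T := measurableTypeR R) r (Borel_param_indic_eball cK')).
have BQ : Borel (fun y => (\1_cube y)%:E) by apply: Borel_indic_closed; exact: closed_cube.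
move: Q0; rewrite (@line_integral_perp (fun y => (\1_(K `&` eball r) y)%:E)); [|exact: B|by move=> y; rewrite lee_fin].
rewrite (@line_integral_perp (fun y => (\1_cube y)%:E)); [|exact: BQ|by move=> y; rewrite lee_fin].
rewrite (@line_integral_perp (fun y => (\1_(steiner u K `&` eball r) y)%:E)); [|exact: B|by move=> y; rewrite lee_fin].
rewrite {1}(row_decomp u x) => -[s1]; rewrite /= -addrA -scalerDl.
have xu := edot_perp uu x; set z := perp x in xu *; set s := edot x u + s1 => zQ.
clearbody z s.
have [zK] := Q _ zQ; rewrite edot_ortho// sqr_edot_ortho// => sc zp.
have Ks t : `|t| <= d -> K (z + (s + t) *: u) /\ ~ K (z + (- (s + t)) *: u).
  move=> /zK; rewrite -addrA -scalerDl edot_ortho// -addrA -scalerBl.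
  by have -> : s + t - 2 * (s + t) = - (s + t) by ring.
have d0 : 0 <= d by lra.
have J0 : chord K z !=set0 by exists (s + 0); have [|] := Ks 0; rewrite ?normr0.
have [a [b [ab JE LE]]] := chordE uu cK vK J0.
have inJ t : K (z + t *: u) <-> a <= t <= b.
  by have : chord K z t <-> `[a, b]%classic t by rewrite JE; rewrite /= in_itv.
have csc : `|edot p u| - eta <= `|s|.
  by rewrite lerBlDl -lerBlDr (le_trans (lerB_dist _ _))// distrC.
have zr : edot z z <= r ^+ 2.
  move: zp; rewrite ler_norml => /andP[_ zp].
  have : 0 <= s ^+ 2 - kappa by rewrite -real_normK ?num_real//; nra.
  by lra.
(* The error 2 kappa has two sources: the squared norm varies by [kappa] over the cube, and r^2
   exceeds |p|^2 by at most [kappa]. *)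
have ms : `|Num.sqrt (r ^+ 2 - edot z z) - `|s| | <= eta.
  apply: (@sqrt_dist_le _ _ `|edot p u| _ kappa) => //.
  rewrite real_normK ?num_real//.
  by move: zp; rewrite !ler_norml => /andP[zp1 zp2]; apply/andP; split; lra.
(* On the cube the height differs from that of [p] by at most [eta], so the trace of the line on the
   cube is no longer than the gain 2 eta. *)
have QI : (line_integral (fun y => (\1_cube y)%:E) z <= (2 * eta)%:E)%E.
  pose I : set R := `[edot p u - eta, edot p u + eta]%classic.
  have -> : (2 * eta)%:E = (\int[mu]_t (\1_I t)%:E)%E.
    rewrite integral_indic ?setIT//; last exact: measurable_itv.
    have muI : mu I = (edot p u + eta - (edot p u - eta))%:E.
      by rewrite lebesgue_measure_itv/= lte_fin ltrD2l gtrN// EFinB.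
    by rewrite [RHS]muI; congr EFin; ring.
  apply: ge0_le_integral => //.
  - exact: (@Borel_line _ _ (fun y => (\1_cube y)%:E)).
  - by apply/measurable_EFinP; apply: measurable_indic; exact: measurable_itv.
  - move=> t _; rewrite lee_fin !indicE; case: (boolP (z + _ \in cube)) => //; rewrite inE => /Q [_].
    by rewrite edot_ortho// => tc _; rewrite mem_set// /I /= in_itv /= -ler_distl.
rewrite (line_integral_itv (chord_setI_eball xu r0 zr JE)).
rewrite (line_integral_itv (chord_steiner_eball xu r0 zr J0 LE)).
apply: (le_trans (leeD2l _ QI)); rewrite -EFinD lee_fin.
apply: (@centered_interval_gap _ _ _ s d) => //.
- by rewrite -normr_gt0; lra.
- by have [|/inJ/andP[]] := Ks (- d); rewrite ?normrN ?ger0_norm.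
- by have [|/inJ/andP[]] := Ks d; rewrite ?ger0_norm.
- by move=> t /Ks[_ nK] /inJ.
Qed.

End LineInequality.

(** * From lines to volumes, and from volumes to [Omega] *)

Section Layering.
Variables (R : realType) (n : nat) (u : 'rV[R]_n) (K : set 'rV[R]_n).
Hypothesis uu : edot u u = 1.
Hypothesis cK : compact K.
Hypothesis vK : convex_set_rV K.
Notation mu := (@lebesgue_measure R).

Lemma compact_closed_row (A : set 'rV[R]_n) : compact A -> closed A.
Proof. exact: compact_closed (@norm_hausdorff R 'rV[R]_n). Qed.

Lemma Borel_indic_eball (A : set 'rV[R]_n) (r : R) : compact A ->
  Borel (fun y => (\1_(A `&` @eball R n r) y)%:E).
Proof.
move=> /compact_closed_row cA.
exact: (Borel_comp_param (T := measurableTypeR R) r (Borel_param_indic_eball cA)).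
Qed.

Lemma unit_neq0 : u != 0.
Proof. by rewrite -edot_eq0 uu oner_eq0. Qed.

Lemma volume_steiner_eball (r : R) : 0 <= r ->
  (volume (K `&` @eball R n r) <= volume (steiner u K `&` @eball R n r))%E.
Proof.
move=> r0; apply: (le_iter_integral_lines unit_neq0).
- exact: Borel_indic_eball.
- by apply: Borel_indic_eball; exact: compact_steiner.
- by move=> x; rewrite lee_fin.
- by move=> x; rewrite lee_fin.
- by move=> x; exact: line_integral_steiner.
Qed.

Lemma measurable_volume_eball (A : set 'rV[R]_n) : compact A ->
  measurable_fun [set: measurableTypeR R] (fun r : measurableTypeR R => volume (A `&` @eball R n r)).
Proof.
move=> /compact_closed_row cA.
apply: (measurable_iter_integral (Borel_param_indic_eball cA)) => r x.
by rewrite lee_fin.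
Qed.

Lemma volume_ge0 (A : set 'rV[R]_n) : (0 <= volume A)%E.
Proof. by apply: iter_integral_ge0 => x; rewrite lee_fin. Qed.

Lemma measurable_gauss (D : set (measurableTypeR R)) :
  measurable_fun D (fun r : measurableTypeR R => (expR (- r ^+ 2))%:E).
Proof.
apply: measurable_funTS; apply/measurable_EFinP; exact: measurable_gauss_fun.
Qed.

Lemma measurable_Omega (A : set 'rV[R]_n) (D : set (measurableTypeR R)) : compact A ->
  measurable_fun D (fun r : measurableTypeR R => volume (A `&` @eball R n r) * (expR (- r ^+ 2))%:E)%E.
Proof.
move=> cA; apply: emeasurable_funM; last exact: measurable_gauss.
by apply: measurable_funTS; exact: measurable_volume_eball.
Qed.

Lemma measurable_half_line :  measurable (`[0%R, +oo[%classic : set (measurableTypeR R)).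
Proof. exact: measurable_itv. Qed.

(** Finiteness is what makes a positive additive gain a strict inequality in the extended reals. *)
Lemma Omega_fin_num : Omega K \is a fin_num.
Proof.
have [C C0 KC] := volume_eball_bounded (compact_bounded cK) (compact_closed_row cK).
have O0 : (0 <= Omega K)%E.
  by apply: integral_ge0 => r _; rewrite mule_ge0 ?volume_ge0// lee_fin expR_ge0.
rewrite ge0_fin_numE//.
apply: (@le_lt_trans _ _ (\int[mu]_(r in `[0%R, +oo[%classic) (C%:E * (expR (- r ^+ 2))%:E))%E).
  apply: ge0_le_integral; first exact: measurable_half_line.
  - by move=> r _; rewrite mule_ge0 ?volume_ge0// lee_fin expR_ge0.
  - exact: (@measurable_Omega K _ cK).
  - by apply: measurable_funeM; exact: measurable_gauss.
  - by move=> r _; rewrite lee_pmul ?volume_ge0// lee_fin expR_ge0.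
rewrite ge0_integralZl//.
- have := @integral0y_gauss R; rewrite /gauss_fun => ->.
  by rewrite -EFinM ltry.
- exact: measurable_gauss.
Qed.

Lemma Omega_le : (Omega K <= Omega (steiner u K))%E.
Proof.
apply: ge0_le_integral; first exact: measurable_half_line.
- by move=> r _; rewrite mule_ge0 ?volume_ge0// lee_fin expR_ge0.
- exact: (@measurable_Omega K _ cK).
- exact: (@measurable_Omega _ _ (compact_steiner uu cK vK)).
- move=> r; rewrite /= in_itv /= andbT => r0.
  by rewrite lee_wpmul2r ?lee_fin ?expR_ge0//; exact: volume_steiner_eball.
Qed.

(* Pushing an asymmetric point of [K] towards an interior point. *)
Lemma asymmetric_interior : interior K !=set0 -> steiner u K <> K ->
  exists p : 'rV[R]_n, \forall y \near p, K y /\ ~ K (y - (2 * edot y u) *: u).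
Proof.
move=> [z Kz] SK.
have [p0 [Kp0 nKp0]] : exists p0, K p0 /\ ~ K (p0 - (2 * edot p0 u) *: u).
  apply: contrapT => h; apply: SK; apply: (steiner_id uu cK vK) => y Ky.
  by apply: contrapT => nKy; apply: h; exists y.
have cs : continuous (fun y : 'rV[R]_n => y - (2 * edot y u) *: u).
  have cid : continuous (fun y : 'rV[R]_n => y) by move=> y; exact: cvg_id.
  apply: continuous_rowB => //; apply: continuous_scaleu.
  have c2 : continuous (fun y : 'rV[R]_n => edot (y + y) u).
    by apply: continuous_edotl; exact: continuous_rowD.
  have -> // : (fun y : 'rV[R]_n => 2 * edot y u) = (fun y => edot (y + y) u).
  by apply/funext => y; rewrite edotDl mulr_natl.
have oU : open [set y | ~ K (y - (2 * edot y u) *: u)].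
  have := @open_comp _ _ (fun y : 'rV[R]_n => y - (2 * edot y u) *: u) (~` K).
  apply; first by move=> y _; exact: cs.
  exact: (closed_openC (compact_closed_row cK)).
have [e /= e0 eU] := (nbhs_ballP _ _).1 (open_nbhs_nbhs (conj oU nKp0)).
have [f /= f0 fK] := (nbhs_ballP _ _).1 Kz.
pose N := `|z - p0|; have N0 : 0 <= N by exact: normr_ge0.
have eN : 0 < e + N by lra.
(* With this weight [p] is at distance e N / (e + N) < e from [p0], hence still in the open set of
   points whose mirror image misses [K]. *)
pose l := e / (e + N); have l0 : 0 < l by rewrite divr_gt0.
have l1 : l <= 1 by rewrite ler_pdivrMr// mul1r lerDl.
pose p := l *: z + (1 - l) *: p0.
exists p; apply: filterI; last first.
  apply: open_nbhs_nbhs; split => //; apply: eU.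
  rewrite mx_norm_ball /ball_ /= distrC.
  have -> : p - p0 = l *: (z - p0).
    by rewrite /p scalerBl scale1r scalerBr addrA addrAC addrK.
  rewrite normrZ gtr0_norm// -/N /l mulrAC ltr_pdivrMr//.
  by nra.
(* The homothety of centre [p0] and ratio [l] maps the ball of radius [f] around [z] onto this one,
   and by convexity the image stays in [K]. *)
apply/nbhs_ballP; exists (l * f) => /=; first by rewrite mulr_gt0.
move=> y; rewrite mx_norm_ball /ball_ /= => yp.
have -> : y = l *: (z + l^-1 *: (y - p)) + (1 - l) *: p0.
  by rewrite scalerDr scalerA mulfV ?gt_eqF// scale1r addrAC -/p addrC subrK.
apply: vK => //; last by rewrite (ltW l0) l1.
apply: fK; rewrite mx_norm_ball /ball_ /= opprD addrA subrr sub0r normrN.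
by rewrite normrZ gtr0_norm ?invr_gt0// distrC mulrC ltr_pdivrMr// mulrC.
Qed.

Lemma volume_steiner_eball_gap : interior K !=set0 -> steiner u K <> K ->
  exists v r1 r2 : R, [/\ 0 < v, 0 <= r1, r1 < r2 &
    forall r, r1 <= r <= r2 ->
      (volume (K `&` @eball R n r) + v%:E <= volume (steiner u K `&` @eball R n r))%E].
Proof.
move=> Ki SK; have [p pP] := asymmetric_interior Ki SK.
have [/= rho rho0 rhoP] := (nbhs_ballP _ _).1 pP.
have cid : continuous (fun y : 'rV[R]_n => y) by move=> y; exact: cvg_id.
(* A point of u^perp is its own mirror image, so [p] cannot lie there. *)
have c0 : 0 < `|edot p u|.
  rewrite normr_gt0; apply/eqP => pu; have [Kp] := nbhs_singleton pP.
  by rewrite pu mulr0 scale0r subr0.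
(* Half of [rho] is kept for moving inside the cube, half for moving along [u]; the norm of [u] here
   is the maximum norm. *)
pose d := rho / 2 / (1 + `|u|).
have u0 : 0 <= `|u| by exact: normr_ge0.
have d0 : 0 < d by rewrite !divr_gt0// ltr_pwDl.
pose eta := Num.min (d / 3) (`|edot p u| / 2).
have eta0 : 0 < eta by rewrite lt_min !divr_gt0.
have etad : 3 * eta <= d.
  by rewrite mulrC -ler_pdivlMr// ge_min lexx.
have etac : 2 * eta <= `|edot p u|.
  by rewrite mulrC -ler_pdivlMr// ge_min lexx orbT.
pose kappa := `|edot p u| * eta / 4.
have kappa0 : 0 < kappa by rewrite divr_gt0// mulr_gt0.
have kappac : 4 * kappa <= `|edot p u| * eta by rewrite /kappa mulrC divfK.
have n1 : \forall y \near p, `|edot p u - edot y u| < eta.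
  by have /cvgrPdist_lt/(_ _ eta0) := @continuous_edotu R n u p.
have n2 : \forall y \near p, `|edot p p - edot y y| < kappa.
  have ce : continuous (fun y : 'rV[R]_n => edot y y) by exact: continuous_edot.
  by have /cvgrPdist_lt/(_ _ kappa0) := ce p.
have [/= e2 e20 e2P] := (nbhs_ballP _ _).1 (filterI n1 n2).
pose e := Num.min (e2 / 2) (rho / 4).
have e0 : 0 < e by rewrite lt_min !divr_gt0.
pose cube := [set y : 'rV[R]_n | forall i, `|y 0 i - p 0 i| <= e].
have cube_ball (f : R) y : e < f -> cube y -> ball p f y.
  move=> ef yc; split; first exact: lt_trans ef.
  by move=> i j; rewrite (ord1 i) /ball /= /ball_ /= distrC (le_lt_trans (yc j)).
have Q y : cube y -> [/\ forall t, `|t| <= d ->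
          K (y + t *: u) /\ ~ K (y + t *: u - (2 * edot (y + t *: u) u) *: u),
        `|edot y u - edot p u| <= eta & `|edot y y - edot p p| <= kappa].
  move=> yc; have [] : `|edot p u - edot y u| < eta /\ `|edot p p - edot y y| < kappa.
    apply: e2P; apply: cube_ball yc.
    by rewrite gt_min; apply/orP; left; lra.
  move=> /ltW h1 /ltW h2; split; rewrite 1?distrC// => t td.
  apply: rhoP.
  have : ball p (rho / 2) y.
    by apply: cube_ball yc; rewrite gt_min; apply/orP; right; lra.
  rewrite !mx_norm_ball /ball_ /= => h.
  rewrite opprD addrA (le_lt_trans (ler_normB _ _))// [ltRHS]splitr ltr_leD// normrZ.
  rewrite (le_trans (ler_wpM2r u0 td))// /d mulrAC ler_pdivrMr ?ltr_pwDl//.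
  by rewrite ler_pM2l ?divr_gt0// lerDr.
have p0 := edot_ge0 p.
exists ((2 * e) ^+ n), (enorm p), (Num.sqrt (edot p p + kappa)); split.
- by rewrite exprn_gt0// mulr_gt0.
- exact: sqrtr_ge0.
- by rewrite /enorm ltr_sqrt ?ltrDl// ltr_wpDl.
move=> r /andP[r1 r2]; have r0 : 0 <= r by apply: le_trans r1; exact: sqrtr_ge0.
have pr : edot p p <= r ^+ 2 by rewrite -(sqr_sqrtr p0) ler_sqr// nnegrE sqrtr_ge0.
have rp : r ^+ 2 <= edot p p + kappa.
  have pk : 0 <= edot p p + kappa by rewrite addr_ge0// ltW.
  by rewrite -(sqr_sqrtr pk) ler_sqr// nnegrE sqrtr_ge0.
(* Writing the gain as the integral of the indicator of the cube turns the claim into one comparison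
   along lines. *)
rewrite -(iter_integral_cube p e0) -iter_integralD; last 4 first.
- exact: Borel_indic_eball.
- by apply: Borel_indic_closed; exact: closed_cube.
- by move=> x; rewrite lee_fin.
- by move=> x; rewrite lee_fin.
have B1 := Borel_indic_eball r cK.
have B2 : Borel (fun y => (\1_cube y)%:E) by apply: Borel_indic_closed; exact: closed_cube.
apply: (le_iter_integral_lines unit_neq0).
- by move=> d' S g mg; apply: emeasurable_funD; [exact: B1|exact: B2].
- by apply: Borel_indic_eball; exact: compact_steiner.
- by move=> x; rewrite adde_ge0// lee_fin.
- by move=> x; rewrite lee_fin.
- move=> x; rewrite ge0_integralD//.
  + by apply: (line_integral_steiner_gap uu x cK vK eta0 etad etac kappac) => //; rewrite pr rp.
  + exact: (Borel_line x u B1).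
  + exact: (Borel_line x u B2).
Qed.

Lemma Omega_lt : interior K !=set0 -> steiner u K <> K -> (Omega K < Omega (steiner u K))%E.
Proof.
move=> Ki SK; have [v [r1 [r2 [v0 r10 r12 gap]]]] := volume_steiner_eball_gap Ki SK.
(* The weight is smallest at [r2], so every radius in [I] contributes at least [c]. *)
pose I : set R := `[r1, r2]%classic; pose c := v * expR (- r2 ^+ 2).
have c0 : 0 < c by rewrite mulr_gt0// expR_gt0.
have mI : measurable (I : set (measurableTypeR R)) by exact: measurable_itv.
have mI1 (D : set (measurableTypeR R)) :
    measurable_fun D (fun r : measurableTypeR R => (\1_I r)%:E : \bar R).
  by apply/measurable_EFinP; exact: measurable_indic.
have mcI (D : set (measurableTypeR R)) :
    measurable_fun D (fun r : measurableTypeR R => c%:E * (\1_I r)%:E)%E.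
  exact: measurable_funeM.
have cI0 r : (0 <= c%:E * (\1_I r)%:E)%E by rewrite mule_ge0 ?lee_fin ?(ltW c0).
have muI : (\int[mu]_(r in `[0%R, +oo[%classic) (c%:E * (\1_I r)%:E) = (c * (r2 - r1))%:E)%E.
  rewrite (@ge0_integralZl _ _ _ mu _ measurable_half_line _ (mI1 _))//; last by rewrite lee_fin ltW.
  rewrite (@integral_indic _ _ _ mu _ measurable_half_line _ mI).
  have -> : I `&` `[0%R, +oo[ = I.
    apply/setIidl => r; rewrite /I /= !in_itv /= andbT => /andP[+ _].
    exact: le_trans.
  have mu12 : mu I = (r2 - r1)%:E by rewrite lebesgue_measure_itv/= lte_fin r12 EFinB.
  by rewrite [X in (_ * X)%E]mu12 -EFinM.
apply: (@lt_le_trans _ _ (Omega K + (c * (r2 - r1))%:E)%E).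
  by rewrite lteDl ?Omega_fin_num// lte_fin mulr_gt0// subr_gt0.
rewrite -muI /Omega -ge0_integralD//; last 2 first.
- by move=> r _; rewrite mule_ge0 ?volume_ge0// lee_fin expR_ge0.
- exact: (@measurable_Omega K _ cK).
have O0 (A : set 'rV[R]_n) r : (0 <= volume (A `&` @eball R n r) * (expR (- r ^+ 2))%:E)%E.
  by rewrite mule_ge0 ?volume_ge0// lee_fin expR_ge0.
apply: ge0_le_integral; first exact: measurable_half_line.
- by move=> r _; rewrite adde_ge0.
- by apply: emeasurable_funD => //; exact: (@measurable_Omega K _ cK).
- exact: (@measurable_Omega _ _ (compact_steiner uu cK vK)).
move=> r; rewrite /= in_itv /= andbT => r0.
have w0 : (0 <= (expR (- r ^+ 2))%:E :> \bar R)%E by rewrite lee_fin expR_ge0.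
rewrite indicE; case: (boolP (r \in I)) => [|_]; last first.
  by rewrite mule0 adde0 lee_wpmul2r//; exact: volume_steiner_eball.
rewrite inE /I /= in_itv /= => rI; rewrite mule1.
apply: le_trans (lee_wpmul2r w0 (gap r rI)).
rewrite ge0_muleDl ?volume_ge0 ?lee_fin ?(ltW v0)//.
apply: leeD2l; rewrite -EFinM lee_fin.
rewrite ler_pM2l// ler_expR lerN2 ler_sqr ?nnegrE//; last first.
  by rewrite ltW// (le_lt_trans r10).
by case/andP: rI.
Qed.

End Layering.

Unset Implicit Arguments.

Theorem theorem3p1 (R : realType) (n : nat) (K : set 'rV[R]_n) (u : 'rV[R]_n) :
  K !=set0 -> compact K -> convex_set_rV K -> enorm u = 1 ->
  (Omega K <= Omega (steiner u K))%E /\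
  (interior K !=set0 -> (Omega (steiner u K) = Omega K <-> steiner u K = K)).
Proof.
move=> K0 cK vK u1.
have uu : edot u u = 1 by rewrite -(sqr_sqrtr (edot_ge0 u)) -/(enorm u) u1 expr1n.
split; first exact: Omega_le.
move=> Ki; split=> [OE|-> //]; apply: contrapT => SK.
by have := Omega_lt uu cK vK Ki SK; rewrite OE ltxx.
Qed.
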